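(* The standard Cayley graph of the Baumslag-Solitar group $\mathrm{BS}(1,2)=\langle a,t\mid tat^{-1}=a^2\rangle$, i.e. its Cayley graph with respect to the generating set $\{a,t\}$, is shortcut.
   Context: Graphs are $1$-dimensional cell complexes with each edge isometric to $[0,1]$, with geodesic path metric. A cycle $C$ is a graph homeomorphic to a circle; $|C|$ is its number of edges. A cycle in a graph $\Gamma$ is a continuous map $f\colon C\to\Gamma$ sending vertices to vertices and each closed edge onto a closed edge (not necessarily injective). It is isometric if it is an isometric embedding. A connected simplicial graph $\Gamma$ is shortcut if there is $\theta\in\mathbb{N}$ such that every isometric cycle $C\to\Gamma$ has $|C|\le\theta$. *)

(* Defs.v *)
From HB Require Import structures.
From mathcomp Require Import all_boot all_order all_algebra.
From mathcomp Require Import all_classical all_reals ereal.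

Set Implicit Arguments.
Unset Strict Implicit.
Unset Printing Implicit Defensive.

Import Order.TTheory GRing.Theory Num.Theory.

(** * Groups given by generators and relations *)

Section Presentation.
Local Open Scope quotient_scope.
Variable X : choiceType.

(** A letter [(x, true)] stands for the generator [x], and [(x, false)] for its
    inverse. *)
Definition word : Type := seq (X * bool).

Definition inv_letter (l : X * bool) : X * bool := (l.1, ~~ l.2).
Definition inv_word (w : word) : word := rev (map inv_letter w).

Variable rels : set (word * word).

Inductive wcong : word -> word -> Prop :=
| wcong_refl u : wcong u u
| wcong_sym u v : wcong u v -> wcong v u
| wcong_trans v u w : wcong u v -> wcong v w -> wcong u w
| wcong_cat u u' v v' : wcong u u' -> wcong v v' -> wcong (u ++ v) (u' ++ v')
| wcong_cancel l : wcong [:: l; inv_letter l] [::]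
| wcong_rel u v : rels (u, v) -> wcong u v.

Definition wcongb (u v : word) : bool := `[< wcong u v >].

Lemma wcongb_refl : reflexive wcongb.
Proof. by move=> u; apply/asboolP; apply: wcong_refl. Qed.

Lemma wcongb_sym : symmetric wcongb.
Proof. by move=> u v; apply/asboolP/asboolP; apply: wcong_sym. Qed.

Lemma wcongb_trans : transitive wcongb.
Proof.
by move=> v u w /asboolP uv /asboolP vw; apply/asboolP; apply: wcong_trans vw.
Qed.

Definition wcong_equiv := EquivRel wcongb wcongb_refl wcongb_sym wcongb_trans.

Definition presented : Type := {eq_quot wcong_equiv}.
HB.instance Definition _ := Choice.on presented.

Definition of_word (w : word) : presented := \pi_({eq_quot wcong_equiv}) w.
Definition to_word (g : presented) : word :=
  repr (g : {eq_quot wcong_equiv}).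

Lemma to_wordK : cancel to_word of_word.
Proof. exact: reprK. Qed.

Lemma of_wordP u v : of_word u = of_word v <-> wcong u v.
Proof. by split=> [/eqmodP/asboolP|uv] //; apply/eqmodP/asboolP. Qed.

Lemma to_of_word w : wcong (to_word (of_word w)) w.
Proof. by apply/of_wordP; rewrite to_wordK. Qed.

Lemma inv_letterK : involutive inv_letter.
Proof. by case=> x b; rewrite /inv_letter negbK. Qed.

Lemma inv_word_cat u v : inv_word (u ++ v) = inv_word v ++ inv_word u.
Proof. by rewrite /inv_word map_cat rev_cat. Qed.

Lemma inv_wordK : involutive inv_word.
Proof. by move=> w; rewrite /inv_word map_rev revK (mapK inv_letterK). Qed.

Lemma wcong_mulV w : wcong (w ++ inv_word w) [::].
Proof.
elim: w => [|l w IHw]; first exact: wcong_refl.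
rewrite -cat1s inv_word_cat -catA (catA w).
apply: wcong_trans (wcong_cancel l).
rewrite -[X in wcong _ X]/([:: l] ++ [::] ++ [:: inv_letter l]).
by do 2![apply: wcong_cat; first by [apply: wcong_refl | exact: IHw]];
  apply: wcong_refl.
Qed.

Lemma wcong_Vmul w : wcong (inv_word w ++ w) [::].
Proof. by have := wcong_mulV (inv_word w); rewrite inv_wordK. Qed.

Lemma wcong_inv_mul u v : wcong u v -> wcong (inv_word u) (inv_word v).
Proof.
move=> uv; apply: (@wcong_trans (inv_word u ++ v ++ inv_word v)).
  rewrite -[X in wcong X _]cats0; apply: wcong_cat; first exact: wcong_refl.
  exact/wcong_sym/wcong_mulV.
rewrite catA -[X in wcong _ X]cat0s; apply: wcong_cat; last exact: wcong_refl.
apply: wcong_trans (wcong_Vmul u).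
by apply: wcong_cat; [exact: wcong_refl|exact: wcong_sym].
Qed.

Definition pres_one : presented := of_word [::].
Definition pres_mul (g h : presented) : presented :=
  of_word (to_word g ++ to_word h).
Definition pres_inv (g : presented) : presented :=
  of_word (inv_word (to_word g)).

Lemma pres_mulE u v : pres_mul (of_word u) (of_word v) = of_word (u ++ v).
Proof. by apply/of_wordP; apply: wcong_cat; exact: to_of_word. Qed.

Lemma pres_invE u : pres_inv (of_word u) = of_word (inv_word u).
Proof. by apply/of_wordP/wcong_inv_mul/to_of_word. Qed.

Lemma pres_mulA : associative pres_mul.
Proof.
by move=> g h k; rewrite -[g]to_wordK -[h]to_wordK -[k]to_wordK !pres_mulE catA.
Qed.

Lemma pres_mul1g : left_id pres_one pres_mul.
Proof. by move=> g; rewrite -[g]to_wordK pres_mulE. Qed.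

Lemma pres_mulg1 : right_id pres_one pres_mul.
Proof. by move=> g; rewrite -[g]to_wordK pres_mulE cats0. Qed.

Lemma pres_mulVg : left_inverse pres_one pres_inv pres_mul.
Proof.
by move=> g; rewrite -[g]to_wordK pres_invE pres_mulE; apply/of_wordP/wcong_Vmul.
Qed.

Lemma pres_mulgV : right_inverse pres_one pres_inv pres_mul.
Proof.
by move=> g; rewrite -[g]to_wordK pres_invE pres_mulE; apply/of_wordP/wcong_mulV.
Qed.

HB.instance Definition _ := isGroup.Build presented
  pres_mulA pres_mul1g pres_mulg1 pres_mulVg pres_mulgV.

Definition pres_gen (x : X) : presented := of_word [:: (x, true)].

End Presentation.

(** * The Baumslag-Solitar group BS(1,2) *)

Variant bs_generator : Set := genA | genT.

Definition bs_to_bool (x : bs_generator) : bool :=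
  if x is genA then true else false.
Definition bs_of_bool (b : bool) : bs_generator := if b then genA else genT.

Lemma bs_to_boolK : cancel bs_to_bool bs_of_bool.
Proof. by case. Qed.

HB.instance Definition _ := Choice.copy bs_generator (can_type bs_to_boolK).

(** The single relation [t a t^-1 = a a]. *)
Definition bs12_rel : set (word bs_generator * word bs_generator) :=
  [set ([:: (genT, true); (genA, true); (genT, false)],
        [:: (genA, true); (genA, true)])]%classic.

Definition BS12 : groupType := presented bs12_rel.
Definition bs_a : BS12 := pres_gen bs12_rel genA.
Definition bs_t : BS12 := pres_gen bs12_rel genT.

(** * Graphs as 1-dimensional cell complexes *)

(** The direction from [src e] to [tgt e] only serves to parametrize the
    closed 1-cell [e] by [0,1]; loops and multiple edges are allowed. *)
Record graph := Graph {
  gvertex : Type;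
  gedge : Type;
  src : gedge -> gvertex;
  tgt : gedge -> gvertex }.

Definition simplicial_graph (G : graph) : Prop :=
  (forall e : gedge G, src e <> tgt e) /\
  (forall e e' : gedge G,
     (src e = src e' /\ tgt e = tgt e') \/ (src e = tgt e' /\ tgt e = src e') ->
     e = e').

Section Realization.
Local Open Scope ring_scope.
Local Open Scope classical_set_scope.
Variable R : realType.

(** The cell complex of [G] is, as a set, the disjoint union of its vertices
    and its open edges. *)
Inductive realization (G : graph) : Type :=
| Vertex of gvertex G
| EdgePoint of gedge G & {s : R | 0 < s < 1}.

(** The characteristic map [0,1] -> realization of the closed edge [e] (its
    values for [s] outside of [0,1] are never used). *)
Definition edge_point (G : graph) (e : gedge G) (s : R) : realization G :=
  if insub s is Some u then EdgePoint e u
  else if s <= 0 then Vertex (src e) else Vertex (tgt e).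

Definition closed_edge (G : graph) (e : gedge G) : set (realization G) :=
  [set edge_point e s | s in [set s : R | 0 <= s <= 1]].

(** A piecewise linear path is a list of segments [(e, s, s')], each of which
    runs inside the closed edge [e] from its point of parameter [s] to its
    point of parameter [s']. *)
Fixpoint is_path (G : graph) (x : realization G) (p : seq (gedge G * R * R))
    (y : realization G) : Prop :=
  if p is (e, s, s') :: q then
    [/\ 0 <= s <= 1, 0 <= s' <= 1, x = edge_point e s
      & is_path (edge_point e s') q y]
  else x = y.

Definition path_length (G : graph) (p : seq (gedge G * R * R)) : R :=
  \sum_(i <- p) `|i.1.2 - i.2|.

(** The geodesic path metric; it is [+oo] between distinct components. *)
Definition gdist (G : graph) (x y : realization G) : \bar R :=
  ereal_inf [set (path_length p)%:E | p in [set p | is_path x p y]].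

Definition connected_graph (G : graph) : Prop :=
  forall x y : realization G, exists p, is_path x p y.

Definition gcontinuous (G H : graph) (f : realization G -> realization H) :
    Prop :=
  forall (x : realization G) (eps : R), 0 < eps ->
    exists2 delta : R, 0 < delta
      & forall y, (gdist x y < delta%:E)%E -> (gdist (f x) (f y) < eps%:E)%E.

(** The cycle with [n] edges; it is a circle only when [0 < n]. *)
Definition cycle_graph (n : nat) : graph :=
  @Graph 'I_n 'I_n id (@ordS n).

Definition is_cycle (n : nat) (G : graph)
    (f : realization (cycle_graph n) -> realization G) : Prop :=
  [/\ gcontinuous f,
      forall v, exists w, f (Vertex v) = Vertex w
    & forall e, exists e', f @` closed_edge e = closed_edge e'].

Definition isometric_embedding (G H : graph)
    (f : realization G -> realization H) : Prop :=
  forall x y, gdist (f x) (f y) = gdist x y.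

Definition shortcut_graph (G : graph) : Prop :=
  [/\ connected_graph G, simplicial_graph G
    & exists theta : nat, forall (n : nat)
        (f : realization (cycle_graph n) -> realization G),
        (0 < n)%N -> is_cycle f -> isometric_embedding f -> (n <= theta)%N].

End Realization.

(** For each [g] and each [s] in [S] there is one edge, from [g] to [g * s]. *)
Definition cayley_graph (G : groupType) (S : set G) : graph :=
  @Graph G (G * S)%type (fun e => e.1) (fun e => (e.1 * \val e.2)%g).

(* Main.v *)
Require Import Defs.
From mathcomp Require Import all_boot all_order all_algebra.
From mathcomp Require Import all_classical all_reals ereal.
From mathcomp Require Import zify ring lra.

(** Send a to (1, 0) and t to (0, 1) in the semidirect product of Z[1/2] by Z,
    where the second factor acts by doubling.  A word is then an itinerary of a
    walker on the line of heights: the letters t, t^-1 move the walker up and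
    down, and a letter a, a^-1 used at height h adds 2^h or -2^h to the
    position.  This representation of BS(1,2) is faithful ([pos_ht_inj]), so the
    element spelled by a word is the pair of its final position and height.
    In particular words of height 0 commute, and
      (i)   a P a^-1 = P,
      (ii)  t^-1 P a Q a = a t^-1 P Q   and   a P a Q t = P Q t a
    for P, Q of height 0; these rewritings shorten words by 2 and by 1.

    An isometric cycle with n edges is read off as a cyclic word of length n
    that spells the identity and in which an arc of length m spells no element
    of word length less than min(m, n - m) ([isometric_cycle_loop]).  Suppose
    that n > 5.  At the maximal height, backtracks and the peaks t a^b t^-1,
    which equal a^(2b), being too wasteful, there are two consecutive letters
    equal to the same a^b ([exists_top_pair]).  Cut the cycle between them and
    normalise that height to 0.  Then:
    - by (i), no letter a^(-b) occurs at height 0, because together with the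
      letter a^b at the nearer side of the cut it would bound a word a P a^-1
      along at most about half of the cycle;
    - in each half of the cycle, at most one letter a, a^-1 occurs at each
      height h < 0: for two opposite ones this is (i), for two equal ones (ii),
      since each half has an end at height 0 and hence passes from height h to
      height h + 1.
    In each half the letters below the top contribute in absolute value at most
    a sum of distinct powers 2^-1, 2^-2, and so on, which is less than 1, while
    one end of the half is a letter a^b contributing b, and no letter at the
    top contributes with the opposite sign.  So both halves move the position
    strictly in the direction of b, and the word cannot close up
    ([rotated_loop_le5]). *)

Set Implicit Arguments.
Unset Strict Implicit.
Unset Printing Implicit Defensive.

Import Order.TTheory GRing.Theory Num.Theory.
Local Open Scope ring_scope.

(** * The affine representation of BS(1,2) *)

Definition letter : Type := (bs_generator * bool)%type.

Definition a_letter (b : bool) : letter := (genA, b).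
Definition t_letter (b : bool) : letter := (genT, b).

Definition ht_letter (l : letter) : int :=
  match l with (genT, true) => 1 | (genT, false) => -1 | _ => 0 end.

Definition shift_letter (l : letter) : rat :=
  match l with (genA, true) => 1 | (genA, false) => -1 | _ => 0 end.

Definition ht (w : seq letter) : int := \sum_(l <- w) ht_letter l.

(** The first coordinate of the image of [w] in the semidirect product: the
    walker starts at height 0, and a first letter t^e rescales everything that
    follows by 2^e. *)
Fixpoint pos (w : seq letter) : rat :=
  if w is l :: w' then shift_letter l + 2 ^ ht_letter l * pos w' else 0.

Lemma ht_cat u v : ht (u ++ v) = ht u + ht v.
Proof. by rewrite /ht big_cat. Qed.

Lemma ht_cons l w : ht (l :: w) = ht_letter l + ht w.
Proof. by rewrite /ht big_cons. Qed.

Lemma ht_nil : ht [::] = 0.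
Proof. by rewrite /ht big_nil. Qed.

Lemma pos_cat u v : pos (u ++ v) = pos u + 2 ^ ht u * pos v.
Proof.
elim: u => [|l u IH] /=; first by rewrite ht_nil expr0z add0r mul1r.
by rewrite IH ht_cons expfzDr // mulrDr mulrA addrA.
Qed.

(** The relation of BS(1,2) holds in the semidirect product, since
    2^1 * 1 = 1 + 1. *)
Lemma wcong_pos_ht u v : wcong bs12_rel u v -> pos u = pos v /\ ht u = ht v.
Proof.
elim=> {u v} [//|u v _ [-> ->]//|u v w _ [-> ->] _ [-> ->]//|||].
- move=> u u' v v' _ [pu hu] _ [pv hv].
  by rewrite !pos_cat !ht_cat pu hu pv hv.
- by case=> [[] []]; rewrite /ht !big_cons big_nil /=; split.
- by move=> u v [-> ->]; rewrite /ht !big_cons big_nil /=; split.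
Qed.

Definition ev (w : seq letter) : BS12 := of_word bs12_rel w.

Lemma ev_cat u v : ev (u ++ v) = (ev u * ev v)%g.
Proof. by rewrite /ev -pres_mulE. Qed.

Lemma ev_eq_pos_ht u v : ev u = ev v -> pos u = pos v /\ ht u = ht v.
Proof. by move=> /of_wordP/wcong_pos_ht. Qed.

(** * Faithfulness of the representation *)

Lemma ev_nil : ev [::] = 1%g. Proof. by []. Qed.

Lemma ev_cons l w : ev (l :: w) = (ev [:: l] * ev w)%g.
Proof. by rewrite -ev_cat. Qed.

Lemma ev_a : ev [:: a_letter true] = bs_a. Proof. by []. Qed.
Lemma ev_t : ev [:: t_letter true] = bs_t. Proof. by []. Qed.

Lemma ev_inv l : ev [:: inv_letter l] = (ev [:: l])^-1%g.
Proof.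
apply/esym/mulg1_eq; rewrite -ev_cat -ev_nil.
exact/of_wordP/wcong_cancel.
Qed.

Lemma ev_aV : ev [:: a_letter false] = bs_a^-1%g.
Proof. exact: (ev_inv (a_letter true)). Qed.

Lemma ev_tV : ev [:: t_letter false] = bs_t^-1%g.
Proof. exact: (ev_inv (t_letter true)). Qed.

Lemma bs_relation : (bs_t * bs_a = bs_a ^+ 2 * bs_t)%g.
Proof.
apply: (mulIg bs_t^-1%g); rewrite mulgK expg2 -ev_tV -ev_a -ev_t -!ev_cat.
exact/of_wordP/wcong_rel.
Qed.

Lemma bs_relationX m k :
  (bs_t ^+ m * bs_a ^+ k = bs_a ^+ (2 ^ m * k) * bs_t ^+ m)%g.
Proof.
have rel1 j : (bs_t * bs_a ^+ j = bs_a ^+ (2 * j) * bs_t)%g.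
  elim: j => [|j IH]; first by rewrite muln0 !expg0 mulg1 mul1g.
  by rewrite expgS mulgA bs_relation -mulgA IH mulgA -expgnDr mulnS.
elim: m => [|m IH]; first by rewrite mul1n expg0 mul1g mulg1.
by rewrite expgS -mulgA IH mulgA rel1 -mulgA -expgS mulnA expnS.
Qed.

Lemma bs_relationVX m k :
  (bs_t ^+ m * bs_a ^- k = bs_a ^- (2 ^ m * k) * bs_t ^+ m)%g.
Proof.
apply: (mulIg (bs_a ^+ k)%g); rewrite mulgVK -mulgA bs_relationX.
by rewrite mulKg.
Qed.

(** Multiplying on the left by a high power of t keeps the height positive
    along [w], where t a = a^2 t lets all letters a^+-1 be collected on the left
    of the letters t.  The exponents can then be read off from [pos] and [ht]. *)
Lemma clear_denominators w : exists N : nat, forall m, (N <= m)%N ->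
  exists i j p : nat, [/\
    (bs_t ^+ m * ev w = bs_a ^- j * bs_a ^+ i * bs_t ^+ p)%g,
    i%:R - j%:R = 2 ^+ m * pos w & p%:Z = m%:Z + ht w].
Proof.
elim: w => [|l w [N IH]].
  exists 0%N => m _; exists 0%N, 0%N, m.
  by rewrite ev_nil ht_nil mulg1 !expg0 invg1 !mul1g subrr mulr0 addr0.
rewrite ev_cons ht_cons /=; case: l => [[] []].
- exists N => m /IH [i [j [p [e1 e2 e3]]]].
  exists (i + 2 ^ m)%N, j, p; split; last by rewrite e3 add0r.
    rewrite ev_a -(expg1 bs_a) mulgA bs_relationX muln1 -mulgA e1 !mulgA.
    by rewrite addnC expgnDr mulgA (commuteV (commuteX2 _ _ (commute_refl _))).
  by rewrite /= expr0z mul1r mulrDr -e2 natrD natrX; ring.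
- exists N => m /IH [i [j [p [e1 e2 e3]]]].
  exists i, (j + 2 ^ m)%N, p; split; last by rewrite e3 add0r.
    rewrite ev_aV -(expg1 bs_a) mulgA bs_relationVX muln1 -mulgA e1 !mulgA.
    by rewrite expgnDr invgM.
  by rewrite /= expr0z mul1r mulrDr -e2 natrD natrX; ring.
- exists N => m Nm; have [|i [j [p [e1 e2 e3]]]] := IH m.+1; first lia.
  exists i, j, p; split; last by rewrite e3 /=; lia.
    by rewrite ev_t mulgA -expgSr e1.
  by rewrite e2 /= expr1z add0r exprSr mulrA.
- exists N.+1 => [[//|m]] Nm; have [//|i [j [p [e1 e2 e3]]]] := IH m.
  exists i, j, p; split; last by rewrite e3 /=; lia.
    by rewrite ev_tV expgSr -mulgA mulVKg e1.
  by rewrite e2 /= exprN1 add0r exprSr mulrA mulfK.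
Qed.

(** Multiplied by a common power of t, both elements get the form
    a^-j a^i t^p with i - j and p determined by the position and the height. *)
Lemma pos_ht_inj u v : pos u = pos v -> ht u = ht v -> ev u = ev v.
Proof.
move=> epos eht.
have [N Hu] := clear_denominators u; have [N' Hv] := clear_denominators v.
have [i [j [p [e1 e2 e3]]]] := Hu _ (leq_maxl N N').
have [i' [j' [p' [e1' e2' e3']]]] := Hv _ (leq_maxr N N').
apply: (mulgI (bs_t ^+ maxn N N')%g); rewrite e1 e1'.
have <- : p = p' by move: e3 e3'; rewrite eht; lia.
congr (_ * _)%g.
have /eqP : (i + j')%:R = (i' + j)%:R :> rat.
  by move: e2 e2'; rewrite !natrD epos; lra.
rewrite eqr_nat => /eqP eij.
apply: (mulgI (bs_a ^+ (j + j'))%g).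
have -> : (bs_a ^+ (j + j') * (bs_a ^- j * bs_a ^+ i) = bs_a ^+ (j' + i))%g.
  by rewrite addnC !expgnDr -mulgA mulVKg.
by rewrite [in RHS]expgnDr -mulgA mulVKg -expgnDr addnC eij addnC.
Qed.

(** * Shortening words *)

(** A word P of height 0 changes only the position, by an amount independent of
    where the walker is along the line; so P commutes with a. *)
Lemma cancel_word b P : ht P = 0 ->
  pos (a_letter b :: P ++ [:: a_letter (~~ b)]) = pos P /\
  ht (a_letter b :: P ++ [:: a_letter (~~ b)]) = ht P.
Proof.
move=> hP; rewrite /= pos_cat ht_cons ht_cat hP !expr0z /=.
by case: b; rewrite /ht !big_cons big_nil /=; split; lra.
Qed.

(** Two letters a below a descent are carried to one letter a above it, by
    t^-1 a a = a t^-1. *)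
Lemma carry_down_word b P Q : ht P = 0 -> ht Q = 0 ->
  pos (t_letter false :: P ++ a_letter b :: Q ++ [:: a_letter b]) =
    pos (a_letter b :: t_letter false :: P ++ Q) /\
  ht (t_letter false :: P ++ a_letter b :: Q ++ [:: a_letter b]) =
    ht (a_letter b :: t_letter false :: P ++ Q).
Proof.
move=> hP hQ; split; last first.
  by rewrite !(ht_cons, ht_cat) ht_nil hP hQ; case: b.
by rewrite /= !pos_cat hP /= !pos_cat hQ !expr0z exprN1 /=; case: b; field.
Qed.

(** The mirror image: two letters a before an ascent are carried over it, by
    a a t = t a. *)
Lemma carry_up_word b P Q : ht P = 0 -> ht Q = 0 ->
  pos (a_letter b :: P ++ a_letter b :: Q ++ [:: t_letter true]) =
    pos (P ++ Q ++ [:: t_letter true; a_letter b]) /\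
  ht (a_letter b :: P ++ a_letter b :: Q ++ [:: t_letter true]) =
    ht (P ++ Q ++ [:: t_letter true; a_letter b]).
Proof.
move=> hP hQ; split; last first.
  by rewrite !(ht_cons, ht_cat) ht_nil hP hQ; case: b.
by rewrite /= !pos_cat hP /= !pos_cat hQ /= !expr0z expr1z; case: b => /=; ring.
Qed.

(** * Cyclic words with isometric arcs *)

Section Loops.
Implicit Types (l : nat -> letter) (n : nat).

Definition arc_word l p m : seq letter := [seq l i | i <- iota p m].

Definition height l i : int := ht (arc_word l 0 i).

(** The labels of a closed walk of length [n] whose vertices are at least as far
    apart in BS(1,2) as on a circle of length [n].  The labels are indexed
    periodically by nat, so that arcs may wrap around.  The word [u] is an
    arbitrary word spelling the same element as the arc, and the other arc of
    the circle has length [n - m]. *)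
Definition isometric_loop n l : Prop :=
  [/\ forall i, l (i + n)%N = l i,
      pos (arc_word l 0 n) = 0,
      height l n = 0
    & forall p m u, (m <= n)%N -> pos u = pos (arc_word l p m) ->
        ht u = ht (arc_word l p m) -> (minn m (n - m) <= size u)%N].

Lemma arc_word_cat l p m m' :
  arc_word l p (m + m') = arc_word l p m ++ arc_word l (p + m) m'.
Proof. by rewrite /arc_word iotaD map_cat. Qed.

Lemma arc_wordS l p m : arc_word l p m.+1 = l p :: arc_word l p.+1 m.
Proof. by []. Qed.

Lemma arc_wordSr l p m : arc_word l p m.+1 = arc_word l p m ++ [:: l (p + m)%N].
Proof. by rewrite -addn1 arc_word_cat. Qed.

Lemma size_arc_word l p m : size (arc_word l p m) = m.
Proof. by rewrite size_map size_iota. Qed.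

Lemma ht_arc_word l p m : ht (arc_word l p m) = height l (p + m) - height l p.
Proof. by rewrite /height arc_word_cat ht_cat addrC addKr. Qed.

Lemma heightS l i : height l i.+1 = height l i + ht_letter (l i).
Proof. by rewrite /height arc_wordSr ht_cat ht_cons ht_nil addr0. Qed.

Lemma height0 l : height l 0 = 0. Proof. exact: ht_nil. Qed.

Lemma pos_arc_word l m :
  pos (arc_word l 0 m) =
    \sum_(i <- iota 0 m) shift_letter (l i) * 2 ^ height l i.
Proof.
elim: m => [|m IH]; first by rewrite big_nil.
rewrite arc_wordSr pos_cat IH -[in RHS]addn1 iotaD big_cat big_seq1 /=.
by rewrite mulr0 addr0 mulrC.
Qed.

Lemma height_period n l i : isometric_loop n l ->
  height l (i + n) = height l i.
Proof.
case=> per _ hn _; elim: i => [|i IH]; first by rewrite hn height0.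
by rewrite addSn !heightS IH per.
Qed.

(** Replacing a P a^-1 by P gives a word of length j - i - 1, which must not be
    less than the length n - (j - i + 1) of the complementary arc. *)
Lemma loop_no_cancel n l i j b : isometric_loop n l ->
  (i < j)%N -> l i = a_letter b -> l j = a_letter (~~ b) ->
  height l i = height l j -> (n <= 2 * (j - i))%N.
Proof.
move=> [_ _ _ geo] ij li lj hij; rewrite leqNgt; apply/negP => nij.
have [k ek] : exists k, j = (i.+1 + k)%N by exists (j - i.+1)%N; lia.
subst j.
have hP : ht (arc_word l i.+1 k) = 0.
  by rewrite ht_arc_word -hij heightS li /= addr0 subrr.
have eA : arc_word l i k.+2 =
    a_letter b :: arc_word l i.+1 k ++ [:: a_letter (~~ b)].
  by rewrite arc_wordS arc_wordSr li lj.
have [e1 e2] := cancel_word b hP.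
have := geo i k.+2 (arc_word l i.+1 k); rewrite eA e1 e2 size_arc_word.
by move=> /(_ _ erefl erefl); lia.
Qed.

(** The carried word is shorter by one only, so this excludes arcs of length at
    most n / 2. *)
Lemma loop_no_carry_down n l i j k b : isometric_loop n l ->
  (i < j < k)%N -> l i = t_letter false -> l j = a_letter b ->
  l k = a_letter b -> height l i.+1 = height l j -> height l j = height l k ->
  (k < i + n)%N -> (n < 2 * (k.+1 - i))%N.
Proof.
move=> [_ _ _ geo] /andP[ij jk] li lj lk hij hjk kn.
rewrite ltnNge; apply/negP => nik.
have [u eu] : exists u, j = (i.+1 + u)%N by exists (j - i.+1)%N; lia.
have [v ev] : exists v, k = (j.+1 + v)%N by exists (k - j.+1)%N; lia.
subst k j.
have hP : ht (arc_word l i.+1 u) = 0 by rewrite ht_arc_word hij subrr.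
have hQ : ht (arc_word l (i.+1 + u).+1 v) = 0.
  by rewrite ht_arc_word -hjk heightS lj /= addr0 subrr.
have eA : arc_word l i (u + v.+2).+1 = t_letter false :: arc_word l i.+1 u ++
    a_letter b :: arc_word l (i.+1 + u).+1 v ++ [:: a_letter b].
  by rewrite arc_wordS arc_word_cat arc_wordS arc_wordSr li lj lk.
have [e1 e2] := carry_down_word b hP hQ.
have := geo i (u + v.+2).+1
  (a_letter b :: t_letter false ::
     arc_word l i.+1 u ++ arc_word l (i.+1 + u).+1 v).
rewrite eA e1 e2 /= size_cat !size_arc_word => /(_ _ erefl erefl); lia.
Qed.

Lemma loop_no_carry_up n l i j k b : isometric_loop n l ->
  (i < j < k)%N -> l i = a_letter b -> l j = a_letter b ->
  l k = t_letter true -> height l i = height l j -> height l j = height l k ->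
  (k < i + n)%N -> (n < 2 * (k.+1 - i))%N.
Proof.
move=> [_ _ _ geo] /andP[ij jk] li lj lk hij hjk kn.
rewrite ltnNge; apply/negP => nik.
have [u eu] : exists u, j = (i.+1 + u)%N by exists (j - i.+1)%N; lia.
have [v ev] : exists v, k = (j.+1 + v)%N by exists (k - j.+1)%N; lia.
subst k j.
have hP : ht (arc_word l i.+1 u) = 0.
  by rewrite ht_arc_word -hij heightS li /= addr0 subrr.
have hQ : ht (arc_word l (i.+1 + u).+1 v) = 0.
  by rewrite ht_arc_word -hjk heightS lj /= addr0 subrr.
have eA : arc_word l i (u + v.+2).+1 = a_letter b :: arc_word l i.+1 u ++
    a_letter b :: arc_word l (i.+1 + u).+1 v ++ [:: t_letter true].
  by rewrite arc_wordS arc_word_cat arc_wordS arc_wordSr li lj lk.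
have [e1 e2] := carry_up_word b hP hQ.
have := geo i (u + v.+2).+1 (arc_word l i.+1 u ++ arc_word l (i.+1 + u).+1 v ++
  [:: t_letter true; a_letter b]).
rewrite eA e1 e2 /= !size_cat !size_arc_word => /(_ _ erefl erefl) /=; lia.
Qed.

Lemma loop_no_backtrack n l i : isometric_loop n l -> (2 < n)%N ->
  l i.+1 <> inv_letter (l i).
Proof.
move=> [_ _ _ geo] n2 e.
have eA : arc_word l i 2 = [:: l i; inv_letter (l i)] by rewrite /arc_word /= e.
have [e1 e2] := wcong_pos_ht (wcong_cancel bs12_rel (l i)).
by have := geo i 2 [::]; rewrite eA e1 e2 => /(_ _ erefl erefl) /=; lia.
Qed.

(** t a^b t^-1 = a^b a^b. *)
Lemma loop_no_peak1 n l i b : isometric_loop n l -> (5 < n)%N ->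
  l i = t_letter true -> l i.+1 = a_letter b -> l i.+2 <> t_letter false.
Proof.
move=> [_ _ _ geo] n5 e0 e1 e2.
have eA : arc_word l i 3 = [:: t_letter true; a_letter b; t_letter false].
  by rewrite /arc_word /= e0 e1 e2.
have [e3 e4] : pos (arc_word l i 3) = pos [:: a_letter b; a_letter b] /\
    ht (arc_word l i 3) = ht [:: a_letter b; a_letter b].
  by rewrite eA !ht_cons ht_nil /= expr1z !expr0z; case: b {e1 eA} => /=; split.
have := geo i 3 [:: a_letter b; a_letter b].
by rewrite e3 e4 => /(_ _ erefl erefl) /=; lia.
Qed.

(** A walker starting at height 0 that is at or below level [c < 0] has crossed
    down to that level. *)
Lemma height_descent l i c : c < 0 -> height l i <= c ->
  exists2 k, (k < i)%N & l k = t_letter false /\ height l k.+1 = c.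
Proof.
move=> c0; elim: i => [|i IH]; first by rewrite height0; lia.
have [hi _|hi] := leP (height l i) c.
  by have [k ki e] := IH hi; exists k => //; lia.
rewrite heightS => hi1; exists i => //; rewrite heightS.
by move: hi1; case: (l i) => [[] []] /=; split => //; lia.
Qed.

Lemma height_ascent l j e c : (j <= e)%N -> height l j <= c -> c < height l e ->
  exists2 k, (j <= k < e)%N & l k = t_letter true /\ height l k = c.
Proof.
move=> je hj; elim: e je => [|e IH] je.
  by move: je hj; rewrite leqn0 => /eqP ->; lia.
case: (ltngtP j e.+1) je => // [je|ej] _ hc; last by move: hj; rewrite ej; lia.
have [hi|hi] := ltP c (height l e).
  by have [k ki q] := IH je hi; exists k => //; lia.
move: hc; rewrite heightS => hi1.
exists e; first by rewrite ltnSn andbT -ltnS.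
by move: hi1; case: (l e) => [[] []] /=; split => //; lia.
Qed.

Lemma exists_top n l : (0 < n)%N -> isometric_loop n l ->
  exists p, forall i, height l i <= height l p.
Proof.
move=> n0 iso.
have [p _ pmax] :=
  @arg_maxP _ _ _ (Ordinal n0) predT (fun i : 'I_n => height l i) isT.
exists p => i; rewrite (divn_eq i n) addnC.
have -> : height l (i %% n + i %/ n * n)%N = height l (i %% n)%N.
  elim: (i %/ n)%N => [|q IH]; first by rewrite addn0.
  by rewrite mulSn addnCA addnC height_period.
exact: (pmax (Ordinal (ltn_pmod i n0)) isT).
Qed.

(** From a vertex of maximal height the walk must continue by a letter a^b or
    t^-1, and it must have arrived by a letter a^b or t.  As backtracking is
    excluded, some letter a^b lies at this height; a neighbouring letter equal
    to it must exist, or else a^b would be the whole plateau of a peak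
    t a^b t^-1. *)
Lemma exists_top_pair n l : (5 < n)%N -> isometric_loop n l ->
  exists p b, [/\ l p = a_letter b, l p.+1 = a_letter b
    & forall i, height l i <= height l p].
Proof.
move=> n5 iso; have n2 : (2 < n)%N by lia.
have bt i := loop_no_backtrack (i := i) iso n2.
have top_not_t p : (forall i, height l i <= height l p) -> l p <> t_letter true.
  by move=> ptop e; have := ptop p.+1; rewrite heightS e /=; lia.
have top_not_tV p : (forall i, height l i <= height l p.+1) ->
    l p <> t_letter false.
  by move=> ptop e; have := ptop p; rewrite heightS e /=; lia.
have topS p b : l p = a_letter b -> height l p.+1 = height l p.
  by move=> e; rewrite heightS e addr0.
have [p [b [lp ptop]]] : exists p b, l p.+1 = a_letter b /\
    forall i, height l i <= height l p.+1.
  have [q0 q0top] := exists_top (ltnW (ltnW n2)) iso.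
  have [q qtop] : exists q, forall i, height l i <= height l q.+1.
    exists (q0 + n.-1)%N; rewrite -addnS prednK; last by lia.
    by move=> i; rewrite (height_period _ iso).
  have a_before r b : l r = a_letter b ->
      (forall i, height l i <= height l r.+1) ->
      forall i, height l i <= height l r.
    by move=> e rtop i; rewrite -(topS r b).
  case e1: (l q.+1) (top_not_t _ qtop) => [[] b1].
    by exists q, b1.
  case: b1 e1 => // e1 _.
  case e0: (l q) (top_not_tV _ qtop) (bt q) => [[] b0].
    have qtop' := a_before _ _ e0 qtop.
    case: q {e1 qtop} e0 qtop' => [|q] e0 qtop'; last by exists q, b0.
    (* The letter before the top position has index 0; its predecessor is
       found one period later. *)
    exists n.-1, b0; rewrite prednK; last by lia.
    case: iso => per _ hn _; rewrite -[n]add0n per; split=> //.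
    by move=> i; rewrite add0n hn -(height0 l).
  by case: b0 e0 => // _ _; rewrite e1.
have ptop' : forall i, height l i <= height l p.+2 by rewrite (topS p.+1 b).
case e2: (l p.+2) (top_not_t _ ptop') (bt p.+1) => [[] b2].
  rewrite lp => _ /= ne; exists p.+1, b; split => //.
  by rewrite e2; case: b b2 ne {e2 lp} => [] [].
case: b2 e2 => // e2 _ _.
case e0: (l p) (top_not_tV _ ptop) (bt p) => [[] b0].
  rewrite lp => _ /= ne; exists p, b0; split => //.
  - by rewrite lp; case: b b0 ne {e0 lp} => [] [].
  - by move=> i; rewrite -(topS p b0).
case: b0 e0 => // e0 _ _.
by have := loop_no_peak1 iso n5 e0 lp e2.
Qed.

Lemma isometric_loop_rot n l p : isometric_loop n l ->
  isometric_loop n (fun i => l (p + i)%N).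
Proof.
move=> iso; have [per p0 h0 geo] := iso.
have arcE q m : arc_word (fun i => l (p + i)%N) q m = arc_word l (p + q) m.
  by rewrite /arc_word iotaDl -map_comp.
have hp : ht (arc_word l p n) = 0 by rewrite ht_arc_word height_period ?subrr.
have pp : pos (arc_word l 0 p) = pos (arc_word l n p).
  have -> : arc_word l n p = arc_word l 0 p; last by [].
  rewrite /arc_word -[n]addn0 iotaDl -map_comp; apply: eq_map => i /=.
  by rewrite addnC per.
split.
- by move=> i; rewrite addnA per.
- rewrite arcE addn0.
  have : pos (arc_word l 0 (p + n)) = pos (arc_word l 0 (n + p)) by rewrite addnC.
  rewrite !arc_word_cat !pos_cat !add0n p0.
  rewrite -[ht (arc_word l 0 n)]/(height l n) h0 expr0z mul1r add0r -pp.
  move/(canRL (addKr _)); rewrite addNr => /eqP.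
  by rewrite mulf_eq0 expfz_eq0 andbF => /eqP.
- by rewrite /height arcE addn0.
- by move=> q m u mn; rewrite arcE; apply: geo.
Qed.

End Loops.

(** * Dyadic sums *)

(** The sum is part of the geometric sum 1/2 + ... + 1/2^N = 1 - 1/2^N. *)
Lemma sum_dyadic_lt1 (s : seq nat) : uniq s -> 0%N \notin s ->
  \sum_(d <- s) (2 ^- d : rat) < 1.
Proof.
move=> us s0.
have [N sN] : exists N, {in s, forall d, (d <= N)%N}.
  exists (\max_(d <- s) d)%N => d ds; exact: leq_bigmax_seq.
have geomE M : \sum_(d <- iota 1 M) (2 ^- d : rat) = 1 - 2 ^- M.
  elim: M => [|M IH]; first by rewrite big_nil expr0 invr1 subrr.
  rewrite -[in LHS](addn1 M) iotaD big_cat big_seq1 IH /= add1n exprS invfM.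
  by set x := _^-1 in IH *; lra.
have -> : \sum_(d <- s) (2 ^- d : rat) =
    \sum_(d <- iota 1 N | d \in s) 2 ^- d.
  rewrite -[RHS]big_filter; apply: perm_big; apply: uniq_perm => //.
    exact/filter_uniq/iota_uniq.
  move=> d; rewrite mem_filter mem_iota; case ds: (d \in s) => //=.
  have := sN d ds; case: d ds => [ds|d _ /=]; last by lia.
  by rewrite ds in s0.
apply: (@le_lt_trans _ _ (\sum_(d <- iota 1 N) (2 ^- d : rat))).
  rewrite big_mkcond /=; apply: ler_sum => d _.
  by case: ifP => // _; rewrite invr_ge0 exprn_ge0.
by rewrite geomE gtrBl invr_gt0 exprn_gt0.
Qed.

(** The term of [i0] equals 1, the other terms at height 0 are nonnegative, and
    the terms of negative height, lying at distinct heights, cannot outweigh 1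
    by [sum_dyadic_lt1]. *)
Lemma signed_dyadic_sum_gt0 (c : nat -> rat) (h : nat -> int) (s : seq nat) i0 :
  uniq s -> i0 \in s -> h i0 = 0 -> c i0 = 1 ->
  {in s, forall i, h i <= 0 /\ -1 <= c i} ->
  {in s, forall i, h i = 0 -> 0 <= c i} ->
  {in s &, forall i j, c i != 0 -> c j != 0 -> h i = h j -> h i < 0 -> i = j} ->
  0 < \sum_(i <- s) c i * 2 ^ h i.
Proof.
move=> us si0 h0 c0 hc c_top inj.
pose low i := (c i != 0) && (h i < 0).
have lt1 : \sum_(i <- [seq i <- s | low i]) (2 ^ h i : rat) < 1.
  have -> : \sum_(i <- [seq i <- s | low i]) (2 ^ h i : rat) =
      \sum_(d <- [seq `|h i|%N | i <- s & low i]) 2 ^- d.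
    rewrite big_map !big_filter; apply: eq_bigr => i.
    by case/andP=> _ hi; rewrite exprnN; congr (_ ^ _); lia.
  apply: sum_dyadic_lt1.
    rewrite map_inj_in_uniq ?filter_uniq // => i j.
    rewrite !mem_filter => /andP[/andP[ci hi] si] /andP[/andP[cj hj] sj] e.
    by apply: inj => //; lia.
  by apply/mapP => -[i]; rewrite mem_filter => /andP[/andP[_ hi] _]; lia.
apply: (@lt_le_trans _ _ (\sum_(i <- s) ((i == i0)%:R -
    (if low i then 2 ^ h i else 0)))).
  rewrite big_split sumrN -big_mkcond /=; rewrite big_filter in lt1.
  rewrite (bigD1_seq i0) //= eqxx big1 ?addr0 ?subr_gt0 //.
  by move=> i /negPf ->.
rewrite !big_seq; apply: ler_sum => i si.
have [hi ci] := hc i si.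
rewrite /low; case: eqP => [->|_].
  by rewrite h0 c0 ltxx andbF expr0z.
have p2 : 0 < (2 ^ h i : rat) by apply: exprz_gt0.
case: ltP => hi0; last first.
  rewrite andbF subr0; apply: mulr_ge0; last exact: ltW.
  by apply: c_top => //; apply/eqP; rewrite eq_le hi.
rewrite andbT; case: eqP => [->|_] /=; first by rewrite mul0r subrr.
by rewrite sub0r -[leLHS]mulN1r ler_pM2r.
Qed.

(** * Isometric loops have length at most 5 *)

(** The word starts and ends with a^b at its maximal height 0.  Each of the two
    halves [0, n./2[ and [n./2, n[ contains one of these two letters and is a
    sum to which [signed_dyadic_sum_gt0] applies; but the total is 0. *)
Lemma rotated_loop_le5 n (l : nat -> letter) b : isometric_loop n l ->
  l 0%N = a_letter b -> l n.-1 = a_letter b ->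
  (forall i, height l i <= 0) -> (n <= 5)%N.
Proof.
move=> iso l0 ln1 h_le0; rewrite leqNgt; apply/negP => n5.
have [per pos0 hn _] := iso.
have n0 : (0 < n)%N by lia.
have neqE (b1 b2 : bool) : b1 != b2 -> b1 = ~~ b2 by case: b1 b2 => [] [].
have hn1 : height l n.-1 = 0.
  by move: hn; rewrite -[in height l n](prednK n0) heightS ln1 addr0.
have top_sign i b' : (i < n)%N -> height l i = 0 -> l i = a_letter b' -> b' = b.
  move=> ni hi li; apply/eqP; apply/negPn/negP => bb'.
  rewrite (neqE _ _ bb') in li.
  have i0 : i != 0%N.
    by apply/eqP => i0; move: l0; rewrite -{1}i0 li => -[]; move: (b) => [].
  have i1 : i != n.-1.
    by apply/eqP => i1; move: ln1; rewrite -i1 li => -[]; move: (b) => [].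
  have := loop_no_cancel (i := 0) (j := i) iso _ l0 li.
  rewrite height0 hi => /(_ _ erefl).
  have := loop_no_cancel (i := i) (j := n.-1) (b := ~~ b) iso _ li.
  by rewrite negbK hn1 hi => /(_ _ ln1 erefl); lia.
have low_eq i j b1 b2 : l i = a_letter b1 -> l j = a_letter b2 ->
    (i < j < n)%N ->
    (j < n./2)%N || (n./2 <= i)%N ->
    height l i = height l j -> height l i < 0 ->
    False.
  move=> li lj /andP[ij jn] halves hij hi.
  have eb : b2 = b1.
    apply/eqP; apply/negPn/negP => bb; rewrite (neqE _ _ bb) in lj.
    by have := loop_no_cancel iso ij li lj hij; lia.
  rewrite eb in lj; have [jn2|in2] := orP halves.
    (* The first half starts at height 0, so it has descended before [i]. *)
    have [k ki [lk hk]] := height_descent hi (lexx _).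
    have := loop_no_carry_down (i := k) iso _ lk li lj hk hij.
    by rewrite ki ij => /(_ erefl); lia.
  (* The second half ends at height 0, so it ascends after [j]. *)
  have jn1 : (j <= n.-1)%N by lia.
  have [|k /andP[jk kn] [lk hk]] := height_ascent jn1 (lexx (height l j)).
    by rewrite hn1 -hij.
  have jk' : (j < k)%N.
    by rewrite ltn_neqAle jk andbT; apply/eqP => e; move: lk; rewrite -e lj.
  have := loop_no_carry_up (k := k) iso _ li lj lk hij (esym hk).
  by rewrite ij jk' => /(_ erefl); lia.
(* Multiplying by the sign [s] of a^b makes the two end letters positive. *)
pose s := shift_letter (a_letter b).
pose c i := s * shift_letter (l i).
have cE i b' : l i = a_letter b' -> c i = if b' == b then 1 else -1.
  by move=> li; rewrite /c /s li; move: (b) b' {li} => [] [].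
have c_a i : c i != 0 -> exists b', l i = a_letter b'.
  by rewrite /c; case: (l i) => [[] b'] /=; [exists b'|rewrite mulr0 eqxx].
have c_ge i : -1 <= c i.
  have [->//|/c_a[b' /cE ->]] := eqVneq (c i) 0.
  by case: ifP.
have half_gt0 m k i0 : (m + k <= n)%N -> (m + k <= n./2)%N || (n./2 <= m)%N ->
    i0 \in iota m k -> l i0 = a_letter b -> height l i0 = 0 ->
    0 < \sum_(i <- iota m k) c i * 2 ^ height l i.
  move=> mkn halves i0in li0 hi0; apply: (@signed_dyadic_sum_gt0 _ _ _ i0) => //.
  - exact: iota_uniq.
  - by rewrite (cE _ _ li0) eqxx.
  - move=> i; rewrite mem_iota => iin hi.
    have [->//|/c_a[b' li]] := eqVneq (c i) 0.
    by rewrite (cE _ _ li) (top_sign i b') ?eqxx //; lia.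
  - move=> i j; rewrite !mem_iota => iin jin /c_a[b1 li] /c_a[b2 lj] hij hi.
    case: (ltngtP i j) => // ij; exfalso.
      by apply: (low_eq _ _ _ _ li lj _ _ hij hi); lia.
    by apply: (low_eq _ _ _ _ lj li _ _ (esym hij)); rewrite -?hij //; lia.
have : \sum_(i <- iota 0 n) c i * 2 ^ height l i = 0.
  under eq_bigr do rewrite -mulrA.
  by rewrite -mulr_sumr -pos_arc_word pos0 mulr0.
have n2n : (n./2 <= n)%N by lia.
rewrite -{1}(subnKC n2n) iotaD big_cat add0n => sum0.
have s1 := half_gt0 0%N n./2 0%N.
have s2 := half_gt0 n./2 (n - n./2)%N n.-1.
move: sum0; apply/eqP; rewrite gt_eqF //; apply: addr_gt0.
- by apply: s1; rewrite ?mem_iota ?height0 //; lia.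
- by apply: s2; rewrite ?mem_iota //; lia.
Qed.

Theorem isometric_loop_le5 n (l : nat -> letter) :
  isometric_loop n l -> (n <= 5)%N.
Proof.
move=> iso; have [n5|//] := boolP (5 < n)%N; last by rewrite -leqNgt.
have [p [b [lp lp1 ptop]]] := exists_top_pair n5 iso.
apply: (rotated_loop_le5 (b := b) (isometric_loop_rot p.+1 iso)).
- by rewrite addn0.
- case: iso => per _ _ _; rewrite addSnnS prednK ?per //; lia.
- move=> i.
  have -> : height (fun i => l (p.+1 + i)%N) i =
      height l (p.+1 + i) - height l p.+1.
    rewrite -ht_arc_word /height /arc_word.
    by rewrite -[p.+1 in RHS]addn0 iotaDl -map_comp.
  by rewrite [height l p.+1]heightS lp addr0 subr_le0.
Qed.

(** * Distances in graphs *)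

Section Geometry.
Variable R : realType.
Local Open Scope classical_set_scope.

Section Paths.
Variable G : graph.
Implicit Types (x y : realization R G) (p : seq (gedge G * R * R)).

Lemma edge_point0 (e : gedge G) : edge_point e 0 = Vertex R (src e).
Proof. by rewrite /edge_point insubF ?ltxx // lexx. Qed.

Lemma edge_point1 (e : gedge G) : edge_point e 1 = Vertex R (tgt e).
Proof. by rewrite /edge_point insubF ?ltxx ?andbF // ler10. Qed.

Lemma edge_point_val (e : gedge G) (s : {s : R | 0 < s < 1}) :
  edge_point e (val s) = EdgePoint e s.
Proof. by rewrite /edge_point valK. Qed.

Lemma is_path_cat x y z p q :
  is_path x p y -> is_path y q z -> is_path x (p ++ q) z.
Proof.
elim: p x => [|[[e s] s'] p IH] x /=; first by move=> ->.
by move=> [hs hs' -> hp] hq; split => //; apply: IH.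
Qed.

Lemma path_length_cons i p :
  path_length (i :: p) = `|i.1.2 - i.2| + path_length p.
Proof. by rewrite /path_length big_cons. Qed.

(** Extends a function on the vertices to a function that is affine on each
    edge, hence 1-Lipschitz if [rho] varies by at most 1 along each edge. *)
Definition linear_extension (rho : gvertex G -> R) x : R :=
  match x with
  | Vertex v => rho v
  | EdgePoint e s => (1 - val s) * rho (src e) + val s * rho (tgt e)
  end.

Lemma linear_extension_edge rho (e : gedge G) s : 0 <= s <= 1 ->
  linear_extension rho (edge_point e s) =
    (1 - s) * rho (src e) + s * rho (tgt e).
Proof.
move=> /andP[s0 s1]; have [->|sn0] := eqVneq s 0.
  by rewrite edge_point0 /=; ring.
have [->|sn1] := eqVneq s 1; first by rewrite edge_point1 /=; ring.
have hs : 0 < s < 1 by rewrite !lt_neqAle s0 s1 sn1 eq_sym sn0.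
by rewrite [edge_point e s](edge_point_val e (exist _ s hs)).
Qed.

Lemma path_length_ge rho x p y :
  (forall e, `|rho (tgt e) - rho (src e)| <= 1) -> is_path x p y ->
  `|linear_extension rho y - linear_extension rho x| <= path_length p.
Proof.
move=> lip; elim: p x => [|[[e s] s'] p IH] x /=.
  by move=> ->; rewrite subrr normr0 /path_length big_nil.
move=> [hs hs' -> /IH]; rewrite path_length_cons /= => le.
rewrite -(subrKA (linear_extension rho (edge_point e s'))) addrC.
apply: le_trans (ler_normD _ _) _; apply: lerD le.
rewrite !linear_extension_edge //.
have -> : (1 - s') * rho (src e) + s' * rho (tgt e) -
  ((1 - s) * rho (src e) + s * rho (tgt e)) =
  (s' - s) * (rho (tgt e) - rho (src e)) by ring.
by rewrite normrM distrC ler_piMr.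
Qed.

(** A potential [rho] with variation at most 1 along each edge bounds the
    distance from below, because its linear extension is 1-Lipschitz. *)
Lemma gdist_ge (rho : gvertex G -> R) u v :
  (forall e, `|rho (tgt e) - rho (src e)| <= 1) ->
  (`|rho v - rho u|%:E <= gdist (Vertex R u) (Vertex R v))%E.
Proof.
move=> lip; apply: le_ereal_inf_tmp => _ [p hp <-].
rewrite lee_fin; exact: (path_length_ge lip hp).
Qed.

Lemma gdist_le x p y : is_path x p y -> (gdist x y <= (path_length p)%:E)%E.
Proof. by move=> hp; apply: ereal_inf_lbound; exists p. Qed.

End Paths.

(** * The geometry of the Cayley graph *)

Let bs_set : set BS12 := [set bs_a; bs_t].
Let bs_graph := cayley_graph bs_set.

Lemma bs_a_in : bs_a \in bs_set. Proof. by apply/mem_set; left. Qed.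
Lemma bs_t_in : bs_t \in bs_set. Proof. by apply/mem_set; right. Qed.

Definition letter_gen (x : letter) : bs_set :=
  if x.1 is genA then exist _ bs_a bs_a_in else exist _ bs_t bs_t_in.

Lemma ev_letter x : ev [:: x] =
  if x.2 then \val (letter_gen x) else (\val (letter_gen x))^-1%g.
Proof. by case: x => [[] []]; rewrite ?ev_aV ?ev_tV. Qed.

Lemma word_path (g : BS12) (w : seq letter) :
  exists p, @is_path R bs_graph (Vertex R (g : gvertex bs_graph)) p
    (Vertex R ((g * ev w)%g : gvertex bs_graph)) /\
    path_length p = (size w)%:R.
Proof.
elim: w g => [|x w IH] g.
  by exists [::]; rewrite ev_nil mulg1 /path_length big_nil.
rewrite ev_cons mulgA; have [p [hp lp]] := IH (g * ev [:: x])%g.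
rewrite ev_letter in hp *.
pose h := (g * (\val (letter_gen x))^-1)%g.
case: x.2 hp => hp.
  exists (((g, letter_gen x), 0, 1) :: p); split.
    split; rewrite ?lexx ?ler01 // ?edge_point0 // ?edge_point1 //.
  rewrite path_length_cons lp /= sub0r normrN1 -natr1 addrC //.
exists (((h, letter_gen x), 1, 0) :: p); split.
  split; rewrite ?lexx ?ler01 // ?edge_point0 // edge_point1 /=.
  by rewrite /h mulgVK.
by rewrite path_length_cons lp /= subr0 normr1 -natr1 addrC.
Qed.

Lemma bs_gdist_le (g : BS12) (w : seq letter) :
  (gdist (Vertex R (g : gvertex bs_graph))
    (Vertex R ((g * ev w)%g : gvertex bs_graph)) <= (size w)%:R%:E)%E.
Proof. by have [p [hp <-]] := word_path g w; exact: gdist_le. Qed.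

Lemma bs_connected : connected_graph R bs_graph.
Proof.
have to_vertex (x : realization R bs_graph) :
    exists v p q, is_path x p (Vertex R v) /\ is_path (Vertex R v) q x.
  case: x => [v|e s]; first by exists v, [::], [::].
  have hs : 0 <= val s <= 1 by have /andP[h1 h2] := valP s; rewrite !ltW.
  exists (src e), [:: (e, val s, 0)], [:: (e, 0, val s)].
  by rewrite /= lexx ler01 hs edge_point0 edge_point_val.
move=> x y; have [g [p [_ [hp _]]]] := to_vertex x.
have [h [_ [q [_ hq]]]] := to_vertex y.
have [r [hr _]] := word_path g (to_word (g^-1 * h : BS12)%g).
exists (p ++ r ++ q); apply: is_path_cat hp _; apply: is_path_cat hr _.
by rewrite /ev to_wordK mulVKg.
Qed.
End Geometry.

Section Cycles.
Variable R : realType.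
Local Open Scope classical_set_scope.

Lemma generator_letter (s : [set bs_a; bs_t] : set BS12) :
  exists x, \val s = ev [:: (x, true)].
Proof. by have /set_mem[->|->] := valP s; [exists genA | exists genT]. Qed.

(** This is all that is needed for the Cayley graph to be simplicial: a loop at a
    vertex is a trivial word of length 1, and a double edge with reversed
    directions a trivial positive word of length 2. *)
Lemma positive_word_neq1 x y :
  ev [:: (x, true)] <> 1%g /\ ev [:: (x, true); (y, true)] <> 1%g.
Proof.
by split; case: x => [|]; try (case: y => [|]); move=> /(@ev_eq_pos_ht _ [::]) [];
  rewrite /ht !big_cons big_nil.
Qed.

Lemma bs_simplicial :
  simplicial_graph (cayley_graph ([set bs_a; bs_t] : set BS12)).
Proof.
split=> [[g s]|[g s] [g' s']] /=.
  have [x ->] := generator_letter s.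
  rewrite -[X in X = _]mulg1 => /mulgI /esym.
  by case: (positive_word_neq1 x x).
case=> [[<- /mulgI/val_inj <-]//|[-> ]].
have [x ->] := generator_letter s; have [y ->] := generator_letter s'.
rewrite -mulgA -[X in _ = X]mulg1 => /mulgI; rewrite -ev_cat.
by case: (positive_word_neq1 y x).
Qed.

(** * From isometric cycles to isometric loops *)

Definition circular_norm n i : nat := minn (i %% n)%N (n - i %% n)%N.

Lemma circular_normS n i : (0 < n)%N ->
  (circular_norm n i.+1 <= (circular_norm n i).+1)%N /\
  (circular_norm n i <= (circular_norm n i.+1).+1)%N.
Proof.
move=> n0; rewrite /circular_norm modnS; have := ltn_pmod i n0.
case: ifP => [|_]; last by move=> ?; lia.
rewrite /dvdn -addn1 -modnDml addn1 => d lt.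
have /eqP := d; have [lt'|gt|e] := ltngtP (i %% n).+1 n.
- by rewrite modn_small.
- by lia.
- by lia.
Qed.

Lemma circular_norm_mod n i j :
  circular_norm n (i %% n + j) = circular_norm n (i + j).
Proof. by rewrite /circular_norm modnDml. Qed.

Definition cycle_vertex n (n0 : (0 < n)%N) i : gvertex (cycle_graph n) :=
  Ordinal (ltn_pmod i n0).

(** The potential is the circular distance to the first vertex. *)
Lemma cycle_gdist_ge n (n0 : (0 < n)%N) p m : (m <= n)%N ->
  ((minn m (n - m))%:R%:E <= gdist (Vertex R (cycle_vertex n0 p))
     (Vertex R (cycle_vertex n0 (p + m))))%E.
Proof.
move=> mn; pose o i := cycle_vertex n0 i.
pose rho (k : gvertex (cycle_graph n)) : R :=
  (circular_norm n ((k : 'I_n) + (n - p %% n)))%:R.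
have pn : (p %% n <= n)%N by rewrite ltnW ?ltn_pmod.
have rho_p : rho (o p) = 0.
  by rewrite /rho /o /= subnKC // /circular_norm modnn min0n.
have rho_pm : rho (o (p + m)%N) = (minn m (n - m))%:R.
  rewrite /rho /o /= circular_norm_mod -circular_norm_mod addnC.
  have -> : circular_norm n (n - p %% n + (p + m) %% n) = circular_norm n m.
    rewrite /circular_norm modnDmr addnA -(modnDml _ m) -(modnDmr _ p) subnK //.
    by rewrite modnn add0n.
  rewrite /circular_norm; move: mn; rewrite leq_eqVlt => /orP[/eqP->|lt].
    by rewrite modnn subnn minn0 min0n.
  by rewrite modn_small.
have lip (e : gedge (cycle_graph n)) : `|rho (tgt e) - rho (src e)| <= 1.
  rewrite /rho /= circular_norm_mod addSn.
  have [h1 h2] := circular_normS (e + (n - p %% n)) n0.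
  by rewrite ler_norml; move: h1 h2; rewrite -!(ler_nat R) -!natr1; lra.
have := gdist_ge (o p) (o (p + m)%N) lip.
by rewrite rho_p rho_pm subr0 normr_nat.
Qed.

Lemma closed_edge_vertex (G : graph) (e : gedge G) v :
  closed_edge e (Vertex R v) -> v = src e \/ v = tgt e.
Proof.
move=> [s _]; rewrite /edge_point; case: insub => //.
by case: ifP => _ [<-]; [left | right].
Qed.

(** Consecutive vertices of the cycle are the two ends of an edge of the Cayley
    graph, and distinct by isometry, so they differ by a letter.  Distances in
    the circle are bounded below by [cycle_gdist_ge], distances in the Cayley
    graph above by word lengths. *)
Lemma isometric_cycle_loop n
    (f : realization R (cycle_graph n) ->
         realization R (cayley_graph ([set bs_a; bs_t] : set BS12))) :
  (1 < n)%N -> is_cycle f -> isometric_embedding f ->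
  exists l, isometric_loop n l.
Proof.
move=> n1 [_ fv fe] isom; have n0 : (0 < n)%N by lia.
have [w fw] := choice fv.
pose o i := cycle_vertex n0 i.
have oS i : o i.+1 = ordS (o i).
  by apply: val_inj; rewrite /= -addn1 -[in RHS]addn1 modnDml.
have oper i : o (i + n)%N = o i by apply: val_inj; rewrite /= modnDr.
have oK (i : 'I_n) : o i = i by apply: val_inj; rewrite /= modn_small.
have lower p m u : (m <= n)%N -> w (o (p + m)%N) = (w (o p) * ev u)%g ->
    (minn m (n - m) <= size u)%N.
  move=> mn wu; rewrite -(ler_nat R) -lee_fin.
  apply: le_trans (cycle_gdist_ge n0 p mn) _.
  by rewrite -isom !fw wu; exact: bs_gdist_le.
have step (i : 'I_n) : exists x, w (ordS i) = (w i * ev [:: x])%g.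
  have [e' fe'] := fe (i : gedge (cycle_graph n)).
  have vert v : closed_edge (i : gedge (cycle_graph n)) (Vertex R v) ->
      w v = src e' \/ w v = tgt e'.
    move=> iv; apply: closed_edge_vertex.
    by rewrite -fe' -fw; exists (Vertex R v).
  have h0 : w i = src e' \/ w i = tgt e'.
    apply: vert; exists 0; first by rewrite /= lexx ler01.
    by rewrite edge_point0.
  have h1 : w (ordS i) = src e' \/ w (ordS i) = tgt e'.
    apply: vert; exists 1; first by rewrite /= ler01 lexx.
    by rewrite edge_point1.
  have ne : w (ordS i) <> w i.
    move=> e; have := lower i 1%N [::].
    by rewrite addn1 oS oK e ev_nil mulg1 => /(_ n0 erefl) /=; lia.
  have [x sx] := generator_letter e'.2.
  have tgtE : tgt e' = (src e' * ev [:: (x, true)])%g by rewrite -sx.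
  have [h1'|h1'] := h1; have [h0'|h0'] := h0.
  - by case: ne; rewrite h0' h1'.
  - exists (x, false); rewrite h1' h0' tgtE.
    by rewrite (ev_inv (x, true)) mulgK.
  - by exists (x, true); rewrite h1' h0' tgtE.
  - by case: ne; rewrite h0' h1'.
have [l lE] := choice step.
pose l' i := l (o i).
have w_arc p m : w (o (p + m)%N) = (w (o p) * ev (arc_word l' p m))%g.
  elim: m => [|m IH]; first by rewrite addn0 ev_nil mulg1.
  by rewrite addnS oS lE IH arc_wordSr ev_cat mulgA.
have [pos0 ht0] : pos (arc_word l' 0 n) = 0 /\ ht (arc_word l' 0 n) = 0.
  have /esym := w_arc 0%N n; rewrite oper -[X in _ = X]mulg1 => /mulgI.
  by rewrite -ev_nil => /ev_eq_pos_ht [-> ->]; rewrite ht_nil.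
exists l'; split => //; first by move=> i; rewrite /l' oper.
move=> p m u mn pu hu; apply: (lower p) => //.
by rewrite w_arc (pos_ht_inj pu hu).
Qed.

End Cycles.

Theorem theorem7p14 (R : realType) :
  shortcut_graph R (cayley_graph ([set bs_a; bs_t]%classic)).
Proof.
split; [exact: bs_connected | exact: bs_simplicial |].
exists 5%N => n f n0 fc fi.
have [n1|n1] := leqP n 1; first by apply: leq_trans n1 _.
have [l iso] := isometric_cycle_loop n1 fc fi.
exact: isometric_loop_le5 iso.
Qed.
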